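(* Let $K$ be an arbitrary field, let $S=K[x_1,\dots,x_n]$ be the standard graded polynomial ring, let $0\neq I\subset S$ be a graded ideal, and let $<$ be a monomial order on $S$. Assume that the initial ideal $\operatorname{in}_<(I)$ is a stable monomial ideal. If $\beta^S_0(I)=\beta^S_0(\operatorname{in}_<(I))$, then $I$ is componentwise linear.
   Context: For a finitely generated graded $S$-module $M$, $\beta^S_{i,j}(M)=\dim_K \operatorname{Tor}^S_i(M,K)_j$ are the graded Betti numbers and $\beta^S_i(M)=\sum_j\beta^S_{i,j}(M)$ the total Betti numbers; in particular $\beta^S_0(M)$ is the number of minimal generators of $M$. For a monomial $m\neq 1$, $\max(m)$ is the largest index $i$ such that $x_i$ divides $m$. A monomial ideal $J\subset S$ is called stable if, for every monomial $m\in J$ with $m \ne 1$, setting $i=\max(m)$, one has $x_j\cdot \frac{m}{x_i}\in J$ for all $j\le i$. For an integer $d$, $M_{\langle d\rangle}$ is the submodule of $M$ generated by the forms of degree $d$ in $M$. $M$ has a $d$-linear resolution if $\beta^S_{i,j}(M)=0$ whenever $j\neq i+d$. $M$ is componentwise linear if $M_{\langle d\rangle}$ has a $d$-linear resolution for all integers $d$. *)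

(* Defs.v *)
From HB Require Import structures.
From mathcomp Require Import all_boot all_order all_algebra.
From mathcomp Require Export mpoly.

Set Implicit Arguments.
Unset Strict Implicit.
Unset Printing Implicit Defensive.

Import GRing.Theory.
Local Open Scope ring_scope.

Section Ideals.
Variables (K : fieldType) (n : nat).
Local Notation S := {mpoly K[n]}.
Implicit Types (I J A : S -> Prop) (f g : S).

(* The unit ideal is allowed. *)
Definition is_ideal I : Prop :=
  [/\ I 0, forall f g, I f -> I g -> I (f + g) & forall f g, I g -> I (f * g)].

Definition graded_ideal I : Prop :=
  is_ideal I /\ forall f d, I f -> I (pihomog mdeg d f).

Definition nonzero_ideal I : Prop := exists2 f, I f & f != 0.

Definition ideal_gen A : S -> Prop := fun f =>
  exists k (c g : 'I_k -> S), (forall t, A (g t)) /\ f = \sum_t c t * g t.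

Definition monomial_ideal J : Prop :=
  exists A : 'X_{1..n} -> Prop,
    forall f, J f <-> ideal_gen (fun g => exists2 m, A m & g = 'X_[m]) f.

Definition monomial_order (le : rel 'X_{1..n}) : Prop :=
  [/\ [/\ reflexive le, antisymmetric le, transitive le & total le],
      forall m, le 0%MM m
    & forall m1 m2 m, le m1 m2 -> le (m1 + m)%MM (m2 + m)%MM].

Definition is_initial (le : rel 'X_{1..n}) f (m : 'X_{1..n}) : Prop :=
  m \in msupp f /\ forall m', m' \in msupp f -> le m' m.

Definition initial_ideal (le : rel 'X_{1..n}) I : S -> Prop :=
  ideal_gen (fun g => exists f m, [/\ I f, is_initial le f m & g = 'X_[m]]).

Definition is_max_var (m : 'X_{1..n}) (i : 'I_n) : Prop :=
  m i != 0%N /\ forall j : 'I_n, m j != 0%N -> (j <= i)%N.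

Definition stable_ideal J : Prop :=
  monomial_ideal J /\
  forall (m : 'X_{1..n}) (i j : 'I_n),
    J 'X_[m] -> is_max_var m i -> (j <= i)%N -> J ('X_j * 'X_[m - U_(i)]).

(* Forms of integer degree: in a negative degree only 0. *)
Definition is_form (d : int) f : bool :=
  if d is Posz k then f \is k.-homog else f == 0.

Definition ideal_part I (d : int) : S -> Prop :=
  ideal_gen (fun f => I f /\ is_form d f).

End Ideals.

(* Maps between free modules act on row vectors on the right: [gdiff i] maps
   F_{i+1} to F_i, and [gaug] maps F_0 to S. The a-th basis element of F_i is
   placed in degree [gdeg a]. *)
Record gcomplex (K : fieldType) (n : nat) := GComplex {
  grank : nat -> nat;
  gdeg : forall i, 'I_(grank i) -> int;
  gdiff : forall i, 'M[{mpoly K[n]}]_(grank i.+1, grank i);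
  gaug : 'cV[{mpoly K[n]}]_(grank 0)
}.

Section Betti.
Variables (K : fieldType) (n : nat).
Local Notation S := {mpoly K[n]}.
Implicit Types (M : S -> Prop) (F : gcomplex K n).

(* ... -> F_1 -> F_0 -> M -> 0 is exact, with homogeneous maps of degree 0. *)
Definition graded_free_resolution F M : Prop :=
  [/\ forall i (a : 'I_(grank F i.+1)) (b : 'I_(grank F i)),
        is_form (gdeg a - gdeg b) (gdiff F i a b),
      forall a : 'I_(grank F 0), is_form (gdeg a) (gaug F a 0),
      forall f : S, M f <-> exists v : 'rV[S]_(grank F 0), v *m gaug F = f%:M,
      forall v : 'rV[S]_(grank F 0),
        v *m gaug F = 0 <-> exists w, v = w *m gdiff F 0
    & forall i (v : 'rV[S]_(grank F i.+1)),
        v *m gdiff F i = 0 <-> exists w, v = w *m gdiff F i.+1].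

(* K is S/(x_1,...,x_n), so the differential of F (x)_S K is obtained by
   taking the constant coefficients of the entries. *)
Definition tens_diff F i : 'M[K]_(grank F i.+1, grank F i) :=
  map_mx (fun p : S => p@_0%MM) (gdiff F i).

Definition tens_cycles F i : 'M[K]_(grank F i) :=
  match i with
  | 0%N => 1%:M
  | i'.+1 => kermx (tens_diff F i')
  end.

Definition deg_proj F i (j : int) : 'M[K]_(grank F i) :=
  diag_mx (\row_a (gdeg a == j)%:R).

(* dim_K H_i(F (x)_S K)_j, as (cycles of degree j) / (boundaries of degree j). *)
Definition tor_dim F i (j : int) : nat :=
  (\rank (deg_proj F i j :&: tens_cycles F i)%MS
   - \rank (deg_proj F i.+1 j *m tens_diff F i))%N.

(* The sum runs over the degrees occurring in F_i; in the other degrees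
   F_i (x)_S K, hence its homology, is 0. *)
Definition tor_total F i : nat :=
  (\sum_(j <- undup (codom (@gdeg K n F i))) tor_dim F i j)%N.

(* beta_{i,j}(M) = b and beta_i(M) = b, for M an ideal of S: Tor_i(M,K) is
   computed from a graded free resolution of M, and does not depend on the
   choice of the resolution. *)
Definition graded_betti M i (j : int) (b : nat) : Prop :=
  exists2 F, graded_free_resolution F M & tor_dim F i j = b.

Definition total_betti M i (b : nat) : Prop :=
  exists2 F, graded_free_resolution F M & tor_total F i = b.

Definition linear_resolution M (d : int) : Prop :=
  forall i j, j != i%:Z + d -> graded_betti M i j 0.

Definition componentwise_linear M : Prop :=
  forall d : int, linear_resolution (ideal_part M d) d.

End Betti.

(* Main.v *)
Require Import Defs.
From mathcomp Require Import all_boot all_order all_algebra.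
From mathcomp Require Import mpoly.
From Stdlib Require Import ClassicalEpsilon.

(** Let L be the set of leading monomials of elements of I; it is closed under
    multiples and, by assumption, stable. Fix a degree d and choose for each u
    in L of degree d a form g_u in I with leading monomial u. They generate
    the component of I of degree d, and the point is to build a linear resolution
    of the ideal which they generate.

    The hypothesis on Betti numbers gives one fact, [leads_of_linear_part]: a form
    of degree d + 1 in this ideal has leading monomial x_k v with v in L of
    degree d. Otherwise this form could be taken into a minimal Groebner basis of
    I, where it would be redundant as a generator; then I would have fewer
    generators than the initial ideal. That b generators are needed for I, and that
    the initial ideal has at most b minimal monomials, is read off the beginning of
    arbitrary graded free resolutions ([betti0_le_gens],
    [minimal_monomials_le_betti0]).

    Call x_i multiplicative for g_u when i is at least the largest variable index
    of u. By stability, each x_k v as above is uniquely x_i u with x_i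
    multiplicative for g_u. So division in degree d + 1 expresses each
    x_j g_u, with x_j non-multiplicative, as a combination of products x_i g_v with
    x_i multiplicative, through smaller terms: the g_u form a Pommaret basis with
    linear reductions ([pommaret_basis]). These reductions rewrite every
    combination of the g_u into one with multiplicative coefficients, and such
    combinations are determined by their value, since their terms have distinct
    leading monomials.

    The same rewriting shows that the reductions x_j g_u - (reduct), which are
    syzygies with linear entries, generate all syzygies ([syzygies_exact]). For
    Schreyer's order they again form a Pommaret basis with linear reductions,
    where the syzygy for (u, j) has the multiplicative variables x_i, i >= j
    ([syzygies_pommaret]). Iterating gives an exact complex with linear
    differentials, in which all basis elements in homological degree i have
    degree i + d. *)

Set Implicit Arguments.
Unset Strict Implicit.
Unset Printing Implicit Defensive.

Import GRing.Theory.

(** * Supports of polynomials and generated ideals *)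

Section Support.
Local Open Scope ring_scope.
Variables (K : fieldType) (n : nat).
Local Notation S := {mpoly K[n]}.
Implicit Types (f g : S) (m : 'X_{1..n}).

Lemma msupp_addP f g m :
  m \in msupp (f + g) -> m \in msupp f \/ m \in msupp g.
Proof. by move/msuppD_le; rewrite mem_cat => /orP. Qed.

Lemma msupp_mulX f m m' :
  m' \in msupp (f * 'X_[m]) -> exists2 m1, m1 \in msupp f & m' = (m1 + m)%MM.
Proof.
by rewrite (perm_mem (msuppMX f m)) => /mapP[m1 h ->]; exists m1 => //; exact: addmC.
Qed.

Lemma msupp_mul f g m : m \in msupp (f * g) ->
  exists m1 m2, [/\ m1 \in msupp f, m2 \in msupp g & m = (m1 + m2)%MM].
Proof.
by move/msuppM_le/allpairsP=> [[m1 m2] /= [h1 h2 ->]]; exists m1, m2.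
Qed.

Lemma msupp_sumP (T : finType) (F : T -> S) m :
  m \in msupp (\sum_t F t) -> exists t, m \in msupp (F t).
Proof.
move/msupp_sum_le/flattenP=> [s /mapP[t _ ->] h]; by exists t.
Qed.

Lemma ideal_sum (J : S -> Prop) (T : Type) (r : seq T) (P : pred T) (F : T -> S) :
  is_ideal J -> (forall t, P t -> J (F t)) -> J (\sum_(t <- r | P t) F t).
Proof.
by move=> [J0 JD JM] JF; elim/big_rec: _ => // t f Pt Jf; apply: JD => //; exact: JF.
Qed.

Lemma idealZ (J : S -> Prop) c f : is_ideal J -> J f -> J (c *: f).
Proof. by move=> [_ _ JM] Jf; rewrite -mul_mpolyC; apply: JM. Qed.

Lemma ideal_scaleD (J : S -> Prop) c f g :
  is_ideal J -> J f -> J g -> J (f + c *: g).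
Proof. by move=> hJ Jf Jg; case: (hJ) => _ JD _; apply: JD => //; exact: idealZ. Qed.

Lemma ideal_gen_ideal (A : S -> Prop) : is_ideal (ideal_gen A).
Proof.
split=> [|f g|f g].
- exists 0%N, (fun _ => 0), (fun _ => 0); split; first by case.
  by rewrite big_ord0.
- move=> [k [c [p [hp ->]]]] [l [d [q [hq ->]]]].
  exists (k + l)%N, (fun t => match split t with inl i => c i | inr j => d j end),
    (fun t => match split t with inl i => p i | inr j => q j end).
  split=> [t|]; first by case: split.
  rewrite big_split_ord; congr (_ + _); apply: eq_bigr => i _.
    by rewrite (unsplitK (inl i : 'I_k + 'I_l)).
  by rewrite (unsplitK (inr i : 'I_k + 'I_l)).
- move=> [k [c [p [hp ->]]]]; exists k, (fun t => f * c t), p; split=> //.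
  by rewrite mulr_sumr; apply: eq_bigr => t _; rewrite mulrA.
Qed.

Lemma mem_ideal_gen (A : S -> Prop) g : A g -> ideal_gen A g.
Proof.
move=> Ag; exists 1%N, (fun _ => 1), (fun _ => g).
by split=> //; rewrite big_ord1 mul1r.
Qed.

Lemma ideal_gen_min (A J : S -> Prop) :
  is_ideal J -> (forall g, A g -> J g) -> forall f, ideal_gen A f -> J f.
Proof.
move=> hJ AJ f [k [c [g [hg ->]]]]; apply: ideal_sum => // t _.
by case: hJ => _ _; apply; apply: AJ.
Qed.

End Support.

Section Monomials.
Variable n : nat.
Implicit Types m u : 'X_{1..n}.

Lemma mnm_addAC m1 m2 m3 : (m1 + m2 + m3 = m1 + m3 + m2)%MM.
Proof. by rewrite -!addmA (addmC m2). Qed.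

Lemma lem_mdeg_eq m u : (m <= u)%MM -> (mdeg u <= mdeg m)%N -> m = u.
Proof.
move=> h; rewrite -{1}(submK h) mdegD -[X in (_ <= X)%N]add0n leq_add2r leqn0.
by rewrite mdeg_eq0 => /eqP e; rewrite -(submK h) e add0m.
Qed.

End Monomials.

(** * Monomial orders and leading monomials *)

Section Order.
Variables (n : nat) (le : rel 'X_{1..n}).
Implicit Types m : 'X_{1..n}.

(** Only monomials of equal degree are compared: below each monomial there are
    then finitely many others, which [mrank] counts. *)
Definition slt m1 m2 := [&& mdeg m1 == mdeg m2, m1 != m2 & le m1 m2].

Definition mrank m : nat :=
  #|[set m' : 'X_{1..n < (mdeg m).+1} | slt m' m]|.

Hypothesis hle : monomial_order le.

Lemma slt_mdeg m1 m2 : slt m1 m2 -> mdeg m1 = mdeg m2.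
Proof. by case/and3P=> /eqP. Qed.

Lemma sltxx m : slt m m = false.
Proof. by rewrite /slt !eqxx. Qed.

Lemma slt_trans m2 m1 m3 : slt m1 m2 -> slt m2 m3 -> slt m1 m3.
Proof.
case: hle => -[_ ha ht _] _ _ /and3P[/eqP d12 n12 l12] /and3P[/eqP d23 n23 l23].
apply/and3P; split; [by rewrite d12 d23| |exact: ht l12 l23].
by apply/eqP=> e; case/eqP: n12; apply: ha; rewrite l12 e l23.
Qed.

Lemma slt_add2r m m1 m2 : slt m1 m2 -> slt (m1 + m)%MM (m2 + m)%MM.
Proof.
case: hle => _ _ hc /and3P[/eqP d12 n12 l12]; apply/and3P; split.
- by rewrite !mdegD d12.
- by rewrite eqm_add2r.
- exact: hc.
Qed.

Lemma slt_mrank m1 m2 : slt m1 m2 -> (mrank m1 < mrank m2)%N.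
Proof.
move=> h; rewrite /mrank (slt_mdeg h); apply: proper_card.
have b1 : (mdeg m1 < (mdeg m2).+1)%N by rewrite (slt_mdeg h).
apply/properP; split.
  by apply/subsetP=> m; rewrite !inE => /slt_trans; apply.
by exists (BMultinom b1); rewrite inE /= ?sltxx.
Qed.

Lemma max_of_seq (s : seq 'X_{1..n}) :
  s != [::] -> exists2 m, m \in s & forall m', m' \in s -> le m' m.
Proof.
case: hle => -[hr _ ht htot] _ _; elim: s => // x s IH _.
have [->|/IH [m ms hm]] := eqVneq s [::].
  by exists x; rewrite ?mem_head // => m'; rewrite inE => /eqP ->.
case/orP: (htot x m) => h.
  exists m; rewrite ?inE ?ms ?orbT // => m'; rewrite inE => /predU1P[-> //|].
  exact: hm.
exists x; rewrite ?mem_head // => m'; rewrite inE => /predU1P[-> //|/hm h'].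
exact: ht h' h.
Qed.

End Order.

Section Leads.
Local Open Scope ring_scope.
Variables (K : fieldType) (n : nat) (le : rel 'X_{1..n}).
Hypothesis hle : monomial_order le.
Local Notation S := {mpoly K[n]}.
Local Notation slt := (slt le).
Implicit Types (f g : S) (m : 'X_{1..n}) (I V A : S -> Prop).

(** As [slt] compares equal degrees only, a [lead_form] is homogeneous. *)
Definition lead_form f m : Prop :=
  f@_m = 1 /\ forall m', m' \in msupp f -> m' = m \/ slt m' m.

Definition leads I m : Prop := exists2 f, I f & lead_form f m.

Lemma lead_form_homog f m : lead_form f m -> f \is (mdeg m).-homog.
Proof.
by case=> _ h; apply/dhomogP=> m' /h [->//|/slt_mdeg].
Qed.

Lemma lead_form_is_initial f m : lead_form f m -> is_initial le f m.
Proof.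
case=> h1 h2; split; first by rewrite mcoeff_msupp h1 oner_neq0.
move=> m' /h2[->|/and3P[]//]; by case: hle => -[].
Qed.

Lemma lead_form_mulX f m m' :
  lead_form f m -> lead_form (f * 'X_[m']) (m + m')%MM.
Proof.
case=> h1 h2; split; first by rewrite addmC mcoeffMX.
move=> k /msupp_mulX[k1 /h2 [->|h] ->]; [by left|right; exact: slt_add2r].
Qed.

Lemma homog_lead I f d : is_ideal I -> I f -> f \is d.-homog -> f != 0 ->
  exists m c, [/\ c != 0, mdeg m = d, m \in msupp f & lead_form (c *: f) m].
Proof.
move=> hI If /dhomogP hd f0.
have [|m mf hm] := max_of_seq hle (s := msupp f).
  by rewrite msupp_eq0.
have c0 : f@_m != 0 by rewrite -mcoeff_msupp.
exists m, (f@_m)^-1; split; rewrite ?invr_eq0 ?hd //.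
split; first by rewrite mcoeffZ mulVf.
move=> m' /msuppZ_le m'f; have [->|ne] := eqVneq m' m; first by left.
by right; rewrite /slt ne hm // !(hd _ _) // eqxx.
Qed.

(** The initial monomial of [f] is also that of a homogeneous component. *)
Lemma is_initial_leads I f m :
  graded_ideal I -> I f -> is_initial le f m -> leads I m.
Proof.
move=> [hI hg] If [mf hm].
have c0 : f@_m != 0 by rewrite -mcoeff_msupp.
have cE k : (pihomog mdeg (mdeg m) f)@_k = if mdeg k == mdeg m then f@_k else 0.
  case: (mdeg k =P mdeg m) => [e|/eqP ne]; last first.
    by rewrite (dhomog_nemf_coeff (pihomogP _ _ _) ne).
  have -> : f@_k = \sum_(i < mmeasure mdeg f) (pihomog mdeg i f)@_k.
    by rewrite -raddf_sum -pihomog_partitionE.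
  have [lt|ge] := ltnP (mdeg m) (mmeasure mdeg f).
    rewrite (bigD1 (Ordinal lt)) //= [X in _ + X]big1 ?addr0 // => i ne.
    apply: (dhomog_nemf_coeff (pihomogP _ _ _)).
    apply: contra ne => /eqP h; apply/eqP/val_inj; exact: etrans (esym h) e.
  by have := leq_trans (msize_mdeg_lt mf) ge; rewrite ltnn.
exists ((f@_m)^-1 *: pihomog mdeg (mdeg m) f); first by apply: idealZ => //; exact: hg.
split; first by rewrite mcoeffZ cE eqxx mulVf.
move=> m' /msuppZ_le; rewrite mcoeff_msupp cE.
case: (mdeg m' =P mdeg m) => [e|_]; last by rewrite eqxx.
rewrite -mcoeff_msupp => m'f; have [->|ne] := eqVneq m' m; first by left.
by right; apply/and3P; split; [exact/eqP|exact: ne|exact: hm].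
Qed.

Lemma leads_add I m m' : is_ideal I -> leads I m -> leads I (m + m')%MM.
Proof.
move=> [_ _ hM] [f If hf]; exists (f * 'X_[m']); last exact: lead_form_mulX.
by rewrite mulrC; apply: hM.
Qed.

Lemma leads_dvd I m m' : is_ideal I -> (m <= m')%MM -> leads I m -> leads I m'.
Proof.
by move=> hI h1 h2; rewrite -(submK h1) addmC; apply: leads_add.
Qed.

Lemma initial_ideal_supp I f m : graded_ideal I ->
  initial_ideal le I f -> m \in msupp f -> leads I m.
Proof.
move=> hI [k [c [g [hg ->]]]] /msupp_sumP[t].
case: (hg t) => p [u [Ip pu ->]] /msupp_mulX[m1 _ ->]; rewrite addmC.
by apply: leads_add; [case: hI|exact: is_initial_leads pu].
Qed.

Lemma initial_idealX I m : graded_ideal I ->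
  initial_ideal le I 'X_[m] <-> leads I m.
Proof.
move=> hI; split=> [h|[f If hf]].
  by apply: initial_ideal_supp h _ => //; rewrite msuppX mem_head.
by apply: mem_ideal_gen; exists f, m; split=> //; apply: lead_form_is_initial.
Qed.

(** The division algorithm in degree [d]: subtracting a multiple of [g] from
    [f] removes the leading monomial and adds only smaller ones. The predicate
    [P] carries a bound on the monomials that may occur along the way. *)
Lemma lead_reduction V A (P : 'X_{1..n} -> Prop) d :
  is_ideal V -> A 0 -> (forall c f g, A f -> A g -> A (f + c *: g)) ->
  (forall m m', P m -> slt m' m -> P m') ->
  (forall m, leads V m -> mdeg m = d -> P m ->
     exists g, [/\ V g, A g & lead_form g m]) ->
  forall f, V f -> f \is d.-homog -> (forall m, m \in msupp f -> P m) -> A f.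
Proof.
move=> hV A0 AD Pdown hlead f.
have [N] : exists N, forall m, m \in msupp f -> (mrank le m < N)%N.
  exists (\max_(m <- msupp f) mrank le m).+1 => m mf.
  by rewrite ltnS; apply: (leq_bigmax_seq (F := mrank le)).
elim: N f => [|N IH] f hN Vf df Pf.
  have -> // : f = 0.
  apply: msuppnil0; case: (msupp f) hN => // m s /(_ m).
  by rewrite mem_head => /(_ isT).
have [-> //|f0] := eqVneq f 0.
have [m [c [c0 dm mf hm]]] := homog_lead hV Vf df f0.
have [] := hlead m _ dm (Pf m mf); first by exists (c *: f); first exact: idealZ.
move=> g [Vg Ag [hg1 hg2]]; have [hm1 hm2] := hm.
pose h := f - f@_m *: g.
have fE : f = h + f@_m *: g by rewrite /h subrK.
have supp_h k : k \in msupp h -> slt k m.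
  move=> kh; have km : k <> m.
    by move=> e; move: kh; rewrite e mcoeff_msupp mcoeffB mcoeffZ hg1 mulr1 subrr eqxx.
  case: (msupp_addP kh) => [kf|].
    have : k \in msupp (c *: f).
      by move: kf; rewrite !mcoeff_msupp mcoeffZ => ?; apply: mulf_neq0.
    by case/hm2.
  by rewrite -scaleNr => /msuppZ_le /hg2[].
rewrite fE; apply: AD => //; apply: IH.
- by move=> k /supp_h /(slt_mrank hle) lt; apply: leq_trans lt _; apply: hN.
- by rewrite /h -scaleNr; apply: ideal_scaleD.
- by apply/dhomogP=> k /supp_h /slt_mdeg e; exact: etrans e dm.
- by move=> k /supp_h; apply: Pdown; apply: Pf.
Qed.

End Leads.

(** * Total zeroth Betti numbers and numbers of generators *)

Section Betti.
Local Open Scope ring_scope.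
Variables (K : fieldType) (n : nat).
Local Notation S := {mpoly K[n]}.
Implicit Types (M : S -> Prop) (F : gcomplex K n).

Lemma rank_split_idempotents (r q : nat) (T : eqType) (B : 'M[K]_(q, r))
    (E : T -> 'M[K]_r) (s : seq T) :
  (forall i j, E i *m E j = if i == j then E i else 0) ->
  (forall i, (B *m E i <= B)%MS) -> uniq s ->
  (\sum_(i <- s) \rank (B *m E i))%N = \rank (B *m \sum_(i <- s) E i).
Proof.
move=> hE hB; elim: s => [|i s IH] /=; first by rewrite !big_nil mulmx0 mxrank0.
case/andP=> nis us; rewrite !big_cons IH //.
set Es := \sum_(j <- s) E j.
have EiEs : E i *m Es = 0.
  rewrite mulmx_sumr big_seq big1 // => j js; rewrite hE.
  by case: eqP js nis => // -> ->.
have EsEi : Es *m E i = 0.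
  rewrite mulmx_suml big_seq big1 // => j js; rewrite hE.
  by case: eqP js nis => // -> ->.
have EsEs : Es *m Es = Es.
  rewrite {2}/Es mulmx_sumr [RHS]big_seq [LHS]big_seq; apply: eq_bigr => j js.
  rewrite /Es mulmx_suml (bigD1_seq j) //= hE eqxx big1 ?addr0 // => k.
  by rewrite hE => /negPf ->.
have EiEi : E i *m E i = E i by rewrite hE eqxx.
have sub A : (B *m A <= B)%MS -> A *m (E i + Es) = A ->
    (B *m A <= B *m (E i + Es))%MS.
  by case/submxP=> X hX hA; rewrite -hA mulmxA hX -mulmxA submxMl.
have hs : (B *m Es <= B)%MS.
  by rewrite mulmx_sumr summx_sub.
have eqm : (B *m (E i + Es) :=: B *m E i + B *m Es)%MS.
  apply/eqmxP/andP; split; first by rewrite mulmxDr addmx_sub_adds.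
  rewrite addsmx_sub; apply/andP; split; apply: sub => //; rewrite mulmxDr.
    by rewrite EiEi EiEs addr0.
  by rewrite EsEi EsEs add0r.
rewrite eqm mxrank_disjoint_sum //; apply/eqP; rewrite -submx0.
apply/rV_subP=> v; rewrite sub_capmx => /andP[/submxP[X hX] /submxP[Y hY]].
have : v *m E i = v by rewrite hX -!mulmxA EiEi.
by rewrite {1}hY -!mulmxA EsEi !mulmx0 => <-; apply: sub0mx.
Qed.

(** The resolution may be non-minimal. The constant part of its first differential
    preserves degrees, so its rank is the sum of the ranks of its homogeneous
    blocks. *)
Lemma tor_total0E F M : graded_free_resolution F M ->
  tor_total F 0 = (grank F 0 - \rank (tens_diff F 0))%N /\
  (\rank (tens_diff F 0) <= grank F 0)%N.
Proof.
case=> hdeg _ _ _ _; set D := tens_diff F 0.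
split; last exact: rank_leq_col.
have hD j : deg_proj F 1 j *m D = D *m deg_proj F 0 j.
  apply/matrixP=> a b; rewrite mul_diag_mx mul_mx_diag !mxE.
  have [->|ne] := eqVneq (gdeg a) (gdeg b); first by rewrite mulrC.
  suff -> : (gdiff F 0 a b)@_0%MM = 0 by rewrite mulr0 mul0r.
  have := hdeg 0%N a b; have : gdeg a - gdeg b != 0 by rewrite subr_eq0.
  case: (gdeg a - gdeg b) => [k|k] /= hk; last by move/eqP->; rewrite mcoeff0.
  have k0 : mdeg (0%MM : 'X_{1..n}) != k by rewrite mdeg0 eq_sym; exact: hk.
  by move=> h; exact: dhomog_nemf_coeff h k0.
pose degs := undup (codom (@gdeg K n F 0)).
pose E j := deg_proj F 0 j.
have hE i j : E i *m E j = if i == j then E i else 0.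
  apply/matrixP=> a b; rewrite mul_diag_mx.
  have [->|ne] := eqVneq i j; rewrite !mxE.
    by case: (a == b); rewrite ?mulr0n ?mulr0 // mulr1n; case: eqP; rewrite ?mulr1 ?mul0r.
  case: (a == b); rewrite ?mulr0n ?mulr0 // mulr1n.
  by have [->|_] := eqVneq (gdeg a) i; rewrite ?mul0r // (negPf ne) mulr0.
have sumE : \sum_(j <- degs) E j = 1%:M.
  apply/matrixP=> a b; rewrite summxE !mxE.
  have [<-|ne] := eqVneq a b; last first.
    by rewrite big1 ?mulr0n // => j _; rewrite !mxE (negPf ne) mulr0n.
  rewrite (bigD1_seq (gdeg a)) ?undup_uniq //=; last first.
    by rewrite mem_undup codom_f.
  rewrite big1 ?addr0 => [|j ne]; first by rewrite !mxE !eqxx !mulr1n.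
  by rewrite !mxE eqxx eq_sym (negPf ne) mulr1n.
have split (q : nat) (B : 'M[K]_(q, grank F 0)) :
    (forall j, (B *m E j <= B)%MS) ->
    (\sum_(j <- degs) \rank (B *m E j))%N = \rank B.
  move=> hB; rewrite rank_split_idempotents ?undup_uniq //.
  by rewrite sumE mulmx1.
have s0 : (\sum_(j <- degs) \rank (deg_proj F 0 j))%N = grank F 0.
  rewrite -[RHS](mxrank1 K) -(split _ 1%:M) => [|j]; last exact: submx1.
  by apply: eq_bigr => j _; rewrite mul1mx.
have s1 : (\sum_(j <- degs) \rank (deg_proj F 1 j *m D))%N = \rank D.
  rewrite -[RHS]split => [|j]; first by apply: eq_bigr => j _; rewrite hD.
  by rewrite -hD submxMl.
rewrite /tor_total -/degs -s1 -[X in (X - _)%N]s0 -sumnB => [|j _].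
  apply: eq_bigr => j _; rewrite /tor_dim /=; congr (_ - _)%N.
  by rewrite (capmx_idPl (submx1 _)).
by rewrite hD mxrankM_maxr.
Qed.

(** Rewriting each generator of the resolution through the [h t] and reducing
    modulo the variables writes the identity of rank [grank F 0] as the sum of
    a matrix factoring through [c] coordinates and a multiple of the constant
    part of the differential. *)
Lemma betti0_le_gens M b c (h : 'I_c -> S) :
  total_betti M 0 b ->
  (forall t, M (h t)) ->
  (forall f, M f -> exists q : 'I_c -> S, f = \sum_t q t * h t) ->
  (b <= c)%N.
Proof.
case=> F hF <- Mh hM; have [-> _] := tor_total0E hF.
case: hF => _ _ haug hker _.
have /fin_all_exists[v hv] t := (haug (h t)).1 (Mh t).
pose V : 'M[S]_(c, grank F 0) := \matrix_t v t.
have hV : V *m gaug F = \col_t h t.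
  apply/row_matrixP=> t; rewrite row_mul rowK hv.
  by apply/rowP=> j; rewrite !mxE !ord1.
have basisE (a : 'I_(grank F 0)) : exists qw : 'rV[S]_c * 'rV[S]_(grank F 1),
    delta_mx 0 a = qw.1 *m V + qw.2 *m gdiff F 0.
  have Ma : M (gaug F a 0).
    apply/haug; exists (delta_mx 0 a); rewrite -rowE.
    by apply/rowP=> j; rewrite !mxE !ord1.
  have [q hq] := hM _ Ma.
  have : (delta_mx 0 a - (\row_t q t) *m V) *m gaug F = 0.
    rewrite mulmxBl -rowE -mulmxA hV; apply/rowP=> j; rewrite !mxE ord1 hq.
    by apply/eqP; rewrite subr_eq0; apply/eqP/eq_bigr => t _; rewrite !mxE.
  case/hker=> w hw; exists (\row_t q t, w) => /=.
  by rewrite -hw addrC subrK.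
have /fin_all_exists[qw hqw] := basisE.
pose c0 := fun p : S => p@_0%MM.
pose Q := map_mx c0 (\matrix_a (qw a).1).
pose W := map_mx c0 (\matrix_a (qw a).2).
have e1 : 1%:M = Q *m map_mx c0 V + W *m tens_diff F 0.
  rewrite /Q /W /tens_diff -!map_mxM -map_mxD -[LHS](map_mx1 c0).
  congr (map_mx _ _); apply/row_matrixP=> a.
  by rewrite linearD /= !row_mul !rowK -hqw row1.
rewrite leq_subLR -[X in (X <= _)%N](mxrank1 K) e1.
apply: leq_trans (mxrank_add _ _) _; rewrite addnC leq_add //.
  exact: mxrankM_maxr.
by apply: leq_trans (mxrankM_maxl _ _) _; apply: rank_leq_col.
Qed.

(** A monomial minimal in [M] arises from [g] in [M] only through the constant
    term of a multiplier. *)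
Lemma mcoeffM_minimal M (u : 'X_{1..n}) (p g : S) : M g ->
  (forall f, M f -> forall m, m \in msupp f -> (m <= u)%MM -> m = u) ->
  (p * g)@_u = p@_0%MM * g@_u.
Proof.
move=> Mg hu.
have [c pE] : exists q, p = (p@_0%MM)%:MP + q /\ 0%MM \notin msupp q.
  exists (p - (p@_0%MM)%:MP); split; first by rewrite addrC subrK.
  by rewrite mcoeff_msupp mcoeffB mcoeffC eqxx mulr1 subrr eqxx.
case: pE => pE c0; rewrite {1}pE mulrDl mcoeffD mcoeffCM.
suff -> : (c * g)@_u = 0 by rewrite addr0.
apply/eqP; rewrite mcoeff_eq0; apply/negP=> /msupp_mul[m1 [m2 [h1 h2 e]]].
have e2 : m2 = u by apply: (hu g) => //; rewrite e lem_addl.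
case/negP: c0; suff <- : m1 = 0%MM by [].
by apply: (@addIm _ m2); rewrite add0m -e e2.
Qed.

(** Reading off the coefficients at minimal monomials gives a linear map on
    the generators of the resolution modulo the variables; it kills the boundaries
    and is onto, since each of these monomials lies in [M]. *)
Lemma minimal_monomials_le_betti0 M b (us : seq 'X_{1..n}) :
  total_betti M 0 b -> uniq us -> (forall u, u \in us -> M 'X_[u]) ->
  (forall u, u \in us -> forall f, M f -> forall m, m \in msupp f ->
     (m <= u)%MM -> m = u) ->
  (size us <= b)%N.
Proof.
case=> F hF <- us_uniq Mus hmin; have [-> hr] := tor_total0E hF.
case: hF => _ _ haug hker _.
pose u t := tnth (in_tuple us) t.
have uP t : u t \in us := mem_tnth t (in_tuple us).
have /fin_all_exists[v hv] t := (haug _).1 (Mus _ (uP t)).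
have Maug (a : 'I_(grank F 0)) : M (gaug F a 0).
  apply/haug; exists (delta_mx 0 a); rewrite -rowE.
  by apply/rowP=> j; rewrite !mxE !ord1.
pose G : 'M[K]_(grank F 0, size us) := \matrix_(a, t) (gaug F a 0)@_(u t).
have hG (q : nat) (w : 'M[S]_(q, grank F 0)) i t :
    ((w *m gaug F) i 0)@_(u t) = (map_mx (fun p : S => p@_0%MM) w *m G) i t.
  rewrite !mxE raddf_sum; apply: eq_bigr => a _; rewrite !mxE /=.
  by apply: mcoeffM_minimal (Maug a) (hmin _ (uP t)).
have DG : tens_diff F 0 *m G = 0.
  apply/matrixP=> i t; rewrite -hG.
  suff -> : gdiff F 0 *m gaug F = 0 by rewrite !mxE mcoeff0.
  apply/row_matrixP=> k; rewrite row_mul row0; apply/hker.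
  by exists (delta_mx 0 k); rewrite -rowE.
have VG : map_mx (fun p : S => p@_0%MM) (\matrix_t v t) *m G = 1%:M.
  apply/matrixP=> s t; rewrite -hG.
  have -> : (\matrix_t v t *m gaug F) s 0 = 'X_[u s].
    have -> : (\matrix_t v t *m gaug F) s 0 = row s (\matrix_t v t *m gaug F) 0 0.
      by rewrite [RHS]mxE.
    by rewrite row_mul rowK hv !mxE.
  rewrite mcoeffX !mxE; congr (_%:R); congr nat_of_bool.
  by rewrite /u !(tnth_nth 0%MM) nth_uniq.
have rG : (size us <= \rank G)%N.
  by rewrite -[X in (X <= _)%N](mxrank1 K) -VG mxrankM_maxr.
rewrite leq_subRL // addnC; apply: leq_trans (leq_add rG (leqnn _)) _.
by rewrite addnC; apply: mulmx0_rank_max.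
Qed.

End Betti.

(** * Linear forms times a homogeneous component *)

Section MinimalLeads.
Local Open Scope ring_scope.
Variables (K : fieldType) (n : nat) (le : rel 'X_{1..n}).
Hypothesis hle : monomial_order le.
Local Notation S := {mpoly K[n]}.
Local Notation slt := (slt le).
Local Notation leads := (leads le).
Local Notation lead_form := (lead_form le).
Implicit Types (f g : S) (m u v : 'X_{1..n}).

Variable I : S -> Prop.
Hypothesis hI : graded_ideal I.

Definition minimal_lead u : Prop :=
  leads I u /\ forall m, leads I m -> (m <= u)%MM -> m = u.

Lemma minimal_lead_dvd m :
  leads I m -> exists2 u, minimal_lead u & (u <= m)%MM.
Proof.
have [k] := ubnP (mdeg m); elim: k m => // k IH m; rewrite ltnS => mk lm.
case: (classic (minimal_lead m)) => [h|nmin]; first by exists m; rewrite ?lepm_refl.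
have [m' [lm' hm' ne]] : exists m', [/\ leads I m', (m' <= m)%MM & m' <> m].
  apply: NNPP => h; apply: nmin; split=> // m' l1 l2.
  by apply: NNPP => ne; apply: h; exists m'.
have lt : (mdeg m' < k)%N.
  by apply: leq_trans mk; rewrite ltnNge; apply/negP=> /(lem_mdeg_eq hm').
have [u hu um'] := IH _ lt lm'.
by exists u => //; apply: lepm_trans um' hm'.
Qed.

(** A proper divisor of [v] in the set of leads can be multiplied up to
    degree [d], hence reaches a divisor of degree one less. *)
Lemma minimal_lead_succ v d : leads I v -> mdeg v = d.+1 ->
  (forall u j, leads I u -> mdeg u = d -> v <> (u + U_(j))%MM) ->
  minimal_lead v.
Proof.
move=> lv dv hv; split=> // m lm mv; apply: NNPP => ne.
have : (v - m)%MM != 0%MM.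
  by apply/eqP=> e; apply: ne; rewrite -(submK mv) e add0m.
have [->|[j hj]] : (v - m)%MM = 0%MM \/ exists j, (v - m)%MM j != 0%N.
- case: (pickP (fun j => (v - m)%MM j != 0%N)) => [j hj|h]; first by right; exists j.
  by left; apply/mnmP=> j; rewrite mnm0E; apply/eqP; move: (h j) => /negbFE.
- by rewrite eqxx.
move=> _; have [mj jv] : (m <= v - U_(j))%MM /\ (U_(j) <= v)%MM.
  move: hj; rewrite mnmBE subn_eq0 -ltnNge => hj.
  split; apply/mnm_lepP=> i; rewrite ?mnmBE mnm1E; case: eqP => [<-|_] //.
  - by rewrite leq_subRL ?add1n //; apply: leq_trans hj.
  - by rewrite subn0; exact: (mnm_lepP mv).
  - by apply: leq_trans hj.
apply: (hv (v - U_(j))%MM j).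
- by apply: leads_dvd mj lm => //; case: hI.
- by move: dv; rewrite -{1}(submK jv) mdegD mdeg1 addn1 => -[].
- by rewrite submK.
Qed.

Hypothesis hb : exists b, total_betti I 0 b /\
  total_betti (initial_ideal le I) 0 b.

(** This is the only place where the equality of the Betti numbers enters. If
    the lead [v] of [f] were not a variable times a lead of degree [d], it would
    be a minimal lead, and [f] could serve as the Groebner basis element for [v].
    But [f] is generated by elements of degree [d], which only involve Groebner
    basis elements other than [f]; so [f] is redundant, and [I] has fewer
    generators than its initial ideal has minimal monomials. *)
Lemma leads_of_linear_part d f v :
  ideal_part I d%:Z f -> lead_form f v -> mdeg v = d.+1 ->
  exists u j, [/\ leads I u, mdeg u = d & v = (u + U_(j))%MM].
Proof.
move=> If fv dv; apply: NNPP => hno.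
case: hI => idI grI; have [I0 ID IM] := idI.
have vI : I f by apply: ideal_gen_min If => // g [].
have minv : minimal_lead v.
  apply: (minimal_lead_succ (d := d)) => //; first by exists f.
  by move=> u j lu du e; apply: hno; exists u, j.
case: hb => b [bI bJ].
have bound us : uniq us -> (forall u, u \in us -> minimal_lead u) -> (size us <= b)%N.
  move=> Uus hus; apply: (minimal_monomials_le_betti0 bJ) => // u /hus [lu hu].
    exact/initial_idealX.
  by move=> g Jg m mg; apply: hu; apply: initial_ideal_supp Jg mg.
(* A longest list of minimal leads exists by [bound], and it contains them all. *)
have [us [Uus hus allus]] : exists us, [/\ uniq us,
    forall u, u \in us -> minimal_lead u & forall u, minimal_lead u -> u \in us].
  apply: NNPP => hus.
  suff ex k : exists us, [/\ uniq us, forall u, u \in us -> minimal_lead u & size us = k].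
    have [us [U h sz]] := ex b.+1.
    by have := bound us U h; rewrite sz ltnn.
  elim: k => [|k [us [U h sz]]]; first by exists [::].
  have [u mu nu] : exists2 u, minimal_lead u & u \notin us.
    apply: NNPP => hn; apply: hus; exists us; split=> // u mu.
    by apply: NNPP => /negP nu; apply: hn; exists u.
  exists (u :: us); split; rewrite /= ?nu ?sz //.
  by move=> w; rewrite inE => /predU1P[-> //|]; apply: h.
pose us' := rem v us.
have size_us' : (size us' < b)%N.
  rewrite size_rem ?allus //; apply: leq_trans (bound us Uus hus).
  by move: (allus v minv); case: (us).
have hus' u : minimal_lead u -> u != v -> u \in us'.
  by move=> mu ne; rewrite mem_rem_uniq // inE ne allus.
have exh (t : 'I_(size us')) : exists h, I h /\ lead_form h (nth 0%MM us' t).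
  have [|[h]] := hus (nth 0%MM us' t); last by exists h.
  by apply: (mem_rem (x := v)); apply: mem_nth.
have /fin_all_exists[h hh] := exh.
pose A g := exists q : 'I_(size us') -> S, g = \sum_t q t * h t.
have idA : is_ideal A.
  split.
  - by exists (fun _ => 0); rewrite big1 // => t _; rewrite mul0r.
  - move=> g1 g2 [q1 ->] [q2 ->]; exists (fun t => q1 t + q2 t).
    by rewrite -big_split; apply: eq_bigr => t _; rewrite mulrDl.
  - move=> g1 g2 [q ->]; exists (fun t => g1 * q t).
    by rewrite mulr_sumr; apply: eq_bigr => t _; rewrite mulrA.
have A_lead u m : u \in us' -> (u <= m)%MM ->
    exists g, [/\ I g, A g & lead_form g m].
  move=> uus um; have tlt : (index u us' < size us')%N by rewrite index_mem.
  have [It lt] := hh (Ordinal tlt); rewrite /= nth_index // in lt.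
  have At : A (h (Ordinal tlt)).
    exists (fun t => (t == Ordinal tlt)%:R).
    rewrite (bigD1 (Ordinal tlt)) //= eqxx mul1r big1 ?addr0 // => t /negPf ->.
    by rewrite mul0r.
  exists (h (Ordinal tlt) * 'X_[m - u]); split.
  - by rewrite mulrC; apply: IM.
  - by rewrite mulrC; case: idA => _ _; apply.
  - by rewrite -{2}(submK um) addmC; apply: lead_form_mulX.
have A0 : A 0 by case: idA.
have AZ c g1 g2 : A g1 -> A g2 -> A (g1 + c *: g2) by apply: ideal_scaleD.
(* A minimal lead dividing a lead of degree at most [d] cannot be [v]. *)
have low D g : (D <= d)%N -> I g -> g \is D.-homog -> A g.
  move=> Dd Ig gD.
  apply: (lead_reduction hle idI A0 AZ (P := fun=> True) _ _ Ig gD) => //.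
  move=> m lm dm _; have [u mu um] := minimal_lead_dvd lm.
  apply: (A_lead u) => //; apply: hus' => //; apply: contraTneq Dd => uv.
  by rewrite -ltnNge -dv -uv -dm -(submK um) mdegD leq_addl.
have Af : A f.
  apply: ideal_gen_min If => // g [Ig /= dg]; exact: low (leqnn d) Ig dg.
have high D g : I g -> g \is D.-homog -> A g.
  move=> Ig gD; apply: (lead_reduction hle idI A0 AZ (P := fun=> True) _ _ Ig gD) => //.
  move=> m lm dm _; have [u mu um] := minimal_lead_dvd lm.
  have [uv|ne] := eqVneq u v; last exact: (A_lead u _ (hus' _ mu ne) um).
  exists (f * 'X_[m - v]); split.
  - by rewrite mulrC; apply: IM.
  - by rewrite mulrC; case: idA => _ _; apply.
  - by rewrite -{2}(submK um) uv addmC; apply: lead_form_mulX.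
suff : (b <= size us')%N by rewrite leqNgt size_us'.
apply: (betti0_le_gens (h := h) bI) => [t|g Ig]; first by case: (hh t).
change (A g); rewrite (pihomog_partitionE (leqnn (mmeasure mdeg g))).
apply: (@ideal_sum K n A) => // i _; apply: (high i); [exact: grI|exact: pihomogP].
Qed.

End MinimalLeads.

(** * Terms of free modules and independence of leading terms *)

Section Terms.
Local Open Scope ring_scope.
Variables (K : fieldType) (n : nat) (le : rel 'X_{1..n}).
Hypothesis hle : monomial_order le.
Local Notation S := {mpoly K[n]}.
Local Notation slt := (slt le).
Implicit Types (m : 'X_{1..n}).

Definition terms r (P : 'X_{1..n} -> 'I_r -> Prop) (z : 'rV[S]_r) : Prop :=
  forall a m, m \in msupp (z 0 a) -> P m a.

Lemma termsW r (P Q : 'X_{1..n} -> 'I_r -> Prop) z :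
  (forall m a, P m a -> Q m a) -> terms P z -> terms Q z.
Proof. by move=> PQ hz a m /hz; apply: PQ. Qed.

Lemma terms0 r (P : 'X_{1..n} -> 'I_r -> Prop) : terms P 0.
Proof. by move=> a m; rewrite mxE msupp0. Qed.

Lemma termsD r (P : 'X_{1..n} -> 'I_r -> Prop) z1 z2 :
  terms P z1 -> terms P z2 -> terms P (z1 + z2).
Proof. by move=> h1 h2 a m; rewrite mxE => /msupp_addP[/h1|/h2]. Qed.

Lemma termsC r (P : 'X_{1..n} -> 'I_r -> Prop) (c : K) z :
  terms P z -> terms P (c%:MP *: z).
Proof. by move=> h a m; rewrite mxE mul_mpolyC => /msuppZ_le /h. Qed.

Lemma termsX r (P : 'X_{1..n} -> 'I_r -> Prop) m0 z :
  terms (fun m a => P (m + m0)%MM a) z -> terms P ('X_[m0] *: z).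
Proof.
by move=> h a m; rewrite mxE mulrC => /msupp_mulX[m1 /h hm ->].
Qed.

Lemma terms_delta r (P : 'X_{1..n} -> 'I_r -> Prop) m0 a :
  P m0 a -> terms P ('X_[m0] *: delta_mx 0 a).
Proof.
move=> h b m; rewrite !mxE eqxx /=; case: eqP => [->|_].
  by rewrite mulr1 msuppX inE => /eqP ->.
by rewrite mulr0 msupp0.
Qed.

Lemma row_termsE r (z : 'rV[S]_r) :
  z = \sum_a \sum_(m <- msupp (z 0 a)) ((z 0 a)@_m)%:MP *: ('X_[m] *: delta_mx 0 a).
Proof.
rewrite [LHS]row_sum_delta; apply: eq_bigr => a _.
rewrite {1}[z 0 a]mpolyE scaler_suml; apply: eq_bigr => m _.
by rewrite scalerA mul_mpolyC.
Qed.

(** Schreyer order on the terms of a free module: the basis element [a] is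
    placed at the monomial [mon a], and ties are broken by [wt]. *)
Definition tlt r (mon : 'I_r -> 'X_{1..n}) (wt : 'I_r -> nat) m a m' b : bool :=
  slt (m + mon a)%MM (m' + mon b)%MM
  || (m + mon a == m' + mon b)%MM && (wt a < wt b)%N.

(** The factor exceeds every [wt], so this encodes the lexicographic pair. *)
Definition trank r (mon : 'I_r -> 'X_{1..n}) (wt : 'I_r -> nat) m a : nat :=
  (mrank le (m + mon a)%MM * (\max_b wt b).+1 + wt a)%N.

Section OneModule.
Variables (r : nat) (mon : 'I_r -> 'X_{1..n}) (wt : 'I_r -> nat).
Local Notation tlt := (tlt mon wt).
Local Notation trank := (trank mon wt).

Lemma tlt_trans m2 b m1 a m3 c : tlt m1 a m2 b -> tlt m2 b m3 c -> tlt m1 a m3 c.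
Proof.
rewrite /tlt => /orP[h1|/andP[/eqP-> h1]] /orP[h2|/andP[/eqP e2 h2]].
- by rewrite (slt_trans hle h1 h2).
- by rewrite -e2 h1.
- by rewrite h2.
- by rewrite e2 eqxx (ltn_trans h1 h2) orbT.
Qed.

Lemma tltxx m a : tlt m a m a = false.
Proof. by rewrite /tlt sltxx ltnn andbF. Qed.

Lemma tlt_add k m a m' b : tlt m a m' b -> tlt (m + k)%MM a (m' + k)%MM b.
Proof.
rewrite /tlt ![(_ + k + _)%MM]mnm_addAC => /orP[h|/andP[/eqP-> ->]].
  by rewrite (slt_add2r hle).
by rewrite eqxx orbT.
Qed.

Lemma tlt_mdeg D m a m' b : (forall c, mdeg (mon c) = D) ->
  tlt m a m' b -> mdeg m = mdeg m'.
Proof.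
move=> hD h; have : mdeg (m + mon a)%MM = mdeg (m' + mon b)%MM.
  by case/orP: h => [/slt_mdeg //|/andP[/eqP->]].
by rewrite !mdegD !hD => /addIn.
Qed.

Lemma tlt_trank m a m' b : tlt m a m' b -> (trank m a < trank m' b)%N.
Proof.
rewrite /trank => /orP[/(slt_mrank hle) h|/andP[/eqP-> h]]; last by rewrite ltn_add2l.
apply: leq_trans (leq_addr _ _); apply: leq_trans (leq_mul h (leqnn _)).
by rewrite mulSn addnC ltn_add2r ltnS leq_bigmax.
Qed.

(** If the terms allowed by [Q], multiplied by the lead of their row, are
    pairwise distinct, then the largest of them cannot cancel in [z *m G]. *)
Lemma free_of_leads q (G : 'M[S]_(q, r)) (lm : 'I_q -> 'X_{1..n})
    (lc : 'I_q -> 'I_r) (Q : 'X_{1..n} -> 'I_q -> Prop) :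
  (forall a, (G a (lc a))@_(lm a) = 1) ->
  (forall a b m, m \in msupp (G a b) ->
     (m = lm a /\ b = lc a) \/ tlt m b (lm a) (lc a)) ->
  (forall a b m m', Q m a -> Q m' b ->
     (m + lm a)%MM = (m' + lm b)%MM -> lc a = lc b -> a = b) ->
  forall z, terms Q z -> z *m G = 0 -> z = 0.
Proof.
move=> h1 hlt hinj z Qz zG; apply: NNPP => z0.
pose rk m a := trank (m + lm a)%MM (lc a).
pose P N := [exists a, has (fun m => rk m a == N) (msupp (z 0 a))].
have exP : exists N, P N.
  apply: NNPP => hP; apply: z0; apply/rowP=> a; rewrite mxE.
  apply: msuppnil0; case e: (msupp _) => [//|m s]; case: hP.
  exists (rk m a); apply/existsP; exists a; apply/hasP; exists m => //.
  by rewrite e mem_head.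
have ubP N : P N -> (N <= \max_a \max_(m <- msupp (z 0%R a)) rk m a)%N.
  case/existsP=> a /hasP[m ma /eqP <-]; apply: (bigmax_sup a) => //.
  exact: (leq_bigmax_seq (F := fun m => rk m a)).
case: (ex_maxnP exP ubP) => N /existsP[a /hasP[m ma /eqP rkN]] hmax.
(* Only the term [m] of row [a] contributes to the maximal lead. *)
have small b m1 m2 : m1 \in msupp (z 0 b) -> m2 \in msupp (G b (lc a)) ->
    (m + lm a = m1 + m2)%MM -> a = b /\ m = m1.
  move=> z1 g2 e; have [[e2 ec]|lt] := hlt _ _ _ g2.
    have eab : a = b by apply: hinj (Qz _ _ ma) (Qz _ _ z1) _ _; rewrite // e e2.
    by split=> //; move: e; rewrite e2 -eab => /addIm.
  have : (rk m a < rk m1 b)%N.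
    by rewrite /rk e; apply: tlt_trank; rewrite ![(m1 + _)%MM]addmC; apply: tlt_add.
  rewrite rkN ltnNge hmax //; apply/existsP; exists b; apply/hasP.
  by exists m1.
have /rowP/(_ (lc a)) := zG; rewrite !mxE => /(congr1 (mcoeff (m + lm a)%MM)).
rewrite raddf_sum mcoeff0 (bigD1 a) //= [X in _ + X]big1 ?addr0; last first.
  move=> b ne; apply/eqP; rewrite mcoeff_eq0; apply/negP=> /msupp_mul[m1 [m2 [k1 k2 e]]].
  by case: (small _ _ _ k1 k2 e) => eab; rewrite eab eqxx in ne.
pose c := (z 0 a)@_m; pose z' := z 0 a - c *: 'X_[m].
have zE : z 0 a = z' + c *: 'X_[m] by rewrite subrK.
have z'm : m \notin msupp z'.
  by rewrite mcoeff_msupp mcoeffB mcoeffZ mcoeffX eqxx mulr1 subrr eqxx.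
rewrite zE mulrDl mcoeffD -scalerAl mcoeffZ (mulrC 'X_[m]) mcoeffMX h1 mulr1.
have -> : (z' * G a (lc a))@_(m + lm a) = 0.
  apply/eqP; rewrite mcoeff_eq0; apply/negP=> /msupp_mul[m1 [m2 [k1 k2 e]]].
  have k1' : m1 \in msupp (z 0 a).
    move: (k1); rewrite !mcoeff_msupp mcoeffB mcoeffZ mcoeffX.
    have [e1|_] := eqVneq m m1; first by rewrite e1 k1 in z'm.
    by rewrite mulr0 subr0.
  by case: (small _ _ _ k1' k2 e) => _ e1; rewrite e1 k1 in z'm.
by rewrite add0r => /eqP; apply/negP; rewrite /c -mcoeff_msupp.
Qed.

End OneModule.
End Terms.

(** * Pommaret bases with linear reductions, and their syzygies *)

Section Pommaret.
Local Open Scope ring_scope.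
Variables (K : fieldType) (n : nat) (le : rel 'X_{1..n}).
Hypothesis hle : monomial_order le.
Local Notation S := {mpoly K[n]}.
Local Notation slt := (slt le).
Implicit Types (m : 'X_{1..n}).

Definition vars_ge (c : nat) m : bool :=
  [forall i : 'I_n, (i < c)%N ==> (m i == 0%N)].

Lemma vars_geP c m :
  reflect (forall i : 'I_n, (i < c)%N -> m i = 0%N) (vars_ge c m).
Proof.
apply: (iffP forallP) => h i; first by move=> ic; apply/eqP/(implyP (h i)).
by apply/implyP=> /h ->.
Qed.

Lemma vars_geU c (j : 'I_n) : (c <= j)%N -> vars_ge c U_(j)%MM.
Proof.
move=> cj; apply/vars_geP=> i ic; rewrite mnm1E; apply/eqP; rewrite eqb0.
by apply: contraTneq cj => ->; rewrite -ltnNge.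
Qed.

(** The least variable splits the non-multiplicative monomials into disjoint
    classes, one for each non-multiplicative variable. *)
Lemma min_var c m : ~~ vars_ge c m ->
  exists j : 'I_n, [/\ (j < c)%N, vars_ge j m & (U_(j) <= m)%MM].
Proof.
case/forallPn=> i0; rewrite negb_imply => /andP[i0c mi0].
have [j mj hj] := @arg_minnP _ i0 (fun i => m i != 0%N) (fun i => val i) mi0.
exists j; split; first exact: leq_ltn_trans (hj _ mi0) i0c.
- apply/vars_geP=> i ij; apply/eqP; apply: contraLR ij => /hj.
  by rewrite -leqNgt.
- by apply/mnm_lepP=> i; rewrite mnm1E; case: eqP => // <-; rewrite lt0n.
Qed.

(** Data for generators of a submodule of a free module. The row [a] may be
    multiplied freely by the variables of index at least [pcls a], its
    multiplicative variables; [pmon] and [pwt] define the term order on the free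
    module with one basis element for each row. *)
Record pommaret := Pommaret {
  prows : nat;
  pcols : nat;
  pgens : 'M[S]_(prows, pcols);
  pmon : 'I_prows -> 'X_{1..n};
  pwt : 'I_prows -> nat;
  pcls : 'I_prows -> nat
}.

Definition plt (B : pommaret) := tlt le (@pmon B) (@pwt B).

(** A product of row [a] by a non-multiplicative variable is rewritten with
    multiplicative variables, through strictly smaller terms. In a
    [pommaret_basis] all [pmon] have the same degree, so [p] consists of linear
    forms: this is the source of the linearity of the resolution. *)
Definition linear_reduct (B : pommaret) (a : 'I_(prows B)) (j : 'I_n)
    (p : 'rV[S]_(prows B)) : Prop :=
  terms (fun m b => vars_ge (pcls b) m /\ plt m b U_(j)%MM a) p /\
  'X_j *: row a (pgens B) = p *m pgens B.

Definition pommaret_basis (B : pommaret) : Prop :=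
  [/\ exists D, forall a : 'I_(prows B), mdeg (pmon a) = D,
      forall z : 'rV[S]_(prows B), terms (fun m a => vars_ge (pcls a) m) z ->
        z *m pgens B = 0 -> z = 0
    & forall (a : 'I_(prows B)) (j : 'I_n), (j < pcls a)%N ->
        exists p, linear_reduct a j p].

(** The reduct is chosen from the data alone, so that [syzygies] is a function,
    which can be iterated. *)
Definition reduct (B : pommaret) (a : 'I_(prows B)) (j : 'I_n) :
    'rV[S]_(prows B) :=
  epsilon (inhabits 0) (linear_reduct a j).

Definition nonmult (B : pommaret) : finType :=
  {x : 'I_(prows B) * 'I_n | (x.2 < pcls x.1)%N}.

Definition nm_row (B : pommaret) (t : 'I_#|nonmult B|) : 'I_(prows B) :=
  (val (enum_val t)).1.

Definition nm_var (B : pommaret) (t : 'I_#|nonmult B|) : 'I_n :=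
  (val (enum_val t)).2.

(** The syzygy attached to row [a] and a non-multiplicative variable [j] has
    lead [X_j e_a], and the monomials whose least variable is [j] are [X_j] times
    those in the variables from [j] on: hence the class [j]. The weight encodes
    the lexicographic pair of the old weight and [j], as [j < n]. *)
Definition syzygies (B : pommaret) : pommaret := {|
  prows := #|nonmult B|;
  pcols := prows B;
  pgens := \matrix_(t < #|nonmult B|)
    ('X_(nm_var t) *: delta_mx 0 (nm_row t) - reduct (nm_row t) (nm_var t));
  pmon := fun t => (pmon (nm_row t) + U_(nm_var t))%MM;
  pwt := fun t => (pwt (nm_row t) * n + nm_var t)%N;
  pcls := fun t => nm_var t |}.

Section OneStep.
Variable B : pommaret.
Hypothesis hB : pommaret_basis B.
Local Notation r := (prows B).
Local Notation G := (pgens B).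
Local Notation Syz := (pgens (syzygies B)).
Implicit Types (z : 'rV[S]_r) (a b : 'I_r) (t : 'I_#|nonmult B|).

Lemma nm_varP t : (nm_var t < pcls (nm_row t))%N.
Proof. exact: valP (enum_val t). Qed.

Lemma nm_inj t t' : nm_row t = nm_row t' -> nm_var t = nm_var t' -> t = t'.
Proof.
move=> h1 h2; apply/enum_val_inj/val_inj; move: h1 h2; rewrite /nm_row /nm_var.
by case: (val (enum_val t)) => a i; case: (val (enum_val t')) => a' i' /= -> ->.
Qed.

Lemma nm_ex a (j : 'I_n) : (j < pcls a)%N ->
  exists t, nm_row t = a /\ nm_var t = j.
Proof.
move=> h; exists (enum_rank (Sub (a, j) h : nonmult B)).
by rewrite /nm_row /nm_var enum_rankK.
Qed.

Lemma reductP t : linear_reduct (nm_row t) (nm_var t) (reduct (nm_row t) (nm_var t)).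
Proof.
case: hB => _ _ hred.
exact: epsilon_spec (inhabits 0) _ (hred _ _ (nm_varP t)).
Qed.

Lemma row_syzygies t : row t Syz =
  'X_(nm_var t) *: delta_mx 0 (nm_row t) - reduct (nm_row t) (nm_var t).
Proof. exact: rowK. Qed.

Lemma syzygies_mul0 : Syz *m G = 0.
Proof.
apply/row_matrixP=> t; rewrite row_mul row_syzygies mulmxBl -scalemxAl -rowE.
by rewrite row0 (reductP t).2 subrr.
Qed.

(** A normal form [y] of [z] modulo the syzygies. The predicate [Q] bounds the
    leading terms of the multiples of syzygies spent on reaching it. *)
Definition splits (Q : 'X_{1..n} -> 'I_r -> Prop) z : Prop :=
  exists w y, [/\ z = w *m Syz + y, terms (fun m a => vars_ge (pcls a) m) y
    & terms (fun m t => vars_ge (nm_var t) m /\ Q (m + U_(nm_var t))%MM (nm_row t)) w].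

Lemma splits0 Q : splits Q 0.
Proof. by exists 0, 0; split; rewrite ?mul0mx ?addr0 //; apply: terms0. Qed.

Lemma splits_scaleD Q (c : K) z1 z2 :
  splits Q z1 -> splits Q z2 -> splits Q (z1 + c%:MP *: z2).
Proof.
case=> w1 [y1 [-> hy1 hw1]] [w2 [y2 [-> hy2 hw2]]].
exists (w1 + c%:MP *: w2), (y1 + c%:MP *: y2); split.
- by rewrite mulmxDl -scalemxAl scalerDr addrACA.
- by apply: termsD => //; apply: termsC.
- by apply: termsD => //; apply: termsC.
Qed.

Lemma splits_terms (Q P : 'X_{1..n} -> 'I_r -> Prop) z : terms P z ->
  (forall m a, P m a -> splits Q ('X_[m] *: delta_mx 0 a)) -> splits Q z.
Proof.
move=> Pz h; rewrite [z]row_termsE.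
have hD z1 z2 : splits Q z1 -> splits Q z2 -> splits Q (z1 + z2).
  by move=> h1 h2; rewrite -[z2]scale1r -mpolyC1; apply: splits_scaleD.
elim/big_ind: _ => [|//|a _]; first exact: splits0.
rewrite big_seq; elim/big_ind: _ => [|//|m ma]; first exact: splits0.
rewrite -[X in splits Q X]add0r; apply: splits_scaleD; first exact: splits0.
by apply: h; apply: Pz.
Qed.

(** Well-founded rewriting: in a non-multiplicative term, the product of the basis
    element by its least variable is replaced by the reduct, which is smaller. *)
Lemma all_splits Q z :
  (forall m a m' b, Q m' b -> plt m a m' b -> Q m a) -> terms Q z -> splits Q z.
Proof.
move=> Qdown Qz; apply: (splits_terms Qz) => m a.
have [N] := ubnP (trank le (@pmon B) (@pwt B) m a); elim: N m a => // N IH m a.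
rewrite ltnS => hN Qma.
have [ma|/min_var[j [jc mj jm]]] := boolP (vars_ge (pcls a) m).
  exists 0, ('X_[m] *: delta_mx 0 a); split; rewrite ?mul0mx ?add0r //.
    exact: terms_delta.
  exact: terms0.
have [t [ta tj]] := nm_ex jc.
have [hp _] := reductP t; rewrite ta tj in hp.
have -> : 'X_[m] *: delta_mx 0 a =
    'X_[m - U_(j)] *: reduct a j + 1%:MP *: ('X_[m - U_(j)] *: row t Syz).
  rewrite scale1r row_syzygies ta tj scalerBr addrC subrK scalerA -mpolyXD.
  by rewrite submK.
apply: splits_scaleD.
  apply: (splits_terms (P := fun m' b => plt m' b m a)).
    apply: termsX; apply: termsW hp => m' b [_ /(tlt_add hle (m - U_(j))%MM)].
    by rewrite [in X in _ -> X]/plt (addmC U_(j)%MM) submK.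
  move=> m' b lt; apply: IH; last exact: Qdown Qma lt.
  exact: leq_trans (tlt_trank hle lt) hN.
exists ('X_[m - U_(j)] *: delta_mx 0 t), 0; split.
- by rewrite addr0 -scalemxAl -rowE.
- exact: terms0.
- apply: terms_delta; rewrite ta tj submK //; split=> //.
  by apply/vars_geP=> i ij; rewrite mnmBE (vars_geP _ _ mj) // sub0n.
Qed.

(** For a syzygy, the multiplicative remainder is a syzygy too, so it vanishes. *)
Lemma syzygy_splits (Q : 'X_{1..n} -> 'I_r -> Prop) z :
  (forall m a m' b, Q m' b -> plt m a m' b -> Q m a) ->
  terms Q z -> z *m G = 0 ->
  exists2 w, z = w *m Syz & terms (fun m t =>
    vars_ge (nm_var t) m /\ Q (m + U_(nm_var t))%MM (nm_row t)) w.
Proof.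
move=> Qdown Qz zG; have [w [y [zE hy hw]]] := all_splits Qdown Qz.
exists w => //; case: hB => _ hindep _; rewrite zE (hindep y) ?addr0 //.
by move: zG; rewrite zE mulmxDl -mulmxA syzygies_mul0 mulmx0 add0r.
Qed.

Lemma syzygies_exact z : z *m G = 0 <-> exists w, z = w *m Syz.
Proof.
split=> [zG|[w ->]]; last by rewrite -mulmxA syzygies_mul0 mulmx0.
have [//|//|w zE _] := @syzygy_splits (fun _ _ => True) z _ _ zG.
by exists w.
Qed.

Lemma syzygies_linear t a : Syz t a \is 1.-homog.
Proof.
case: hB => -[D hD] _ _.
rewrite !mxE eqxx /=; apply: rpredB.
  case: (a == _); last by rewrite mulr0; apply: dhomog0.
  by rewrite mulr1; apply/dhomogP=> m; rewrite msuppX inE => /eqP->; apply: mdeg1.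
apply/dhomogP=> m /(reductP t).1 [_ lt].
exact: etrans (tlt_mdeg hD lt) (mdeg1 _).
Qed.

Lemma syzygies_lead t : (Syz t (nm_row t))@_(U_(nm_var t)) = 1.
Proof.
rewrite !mxE !eqxx mulr1 mcoeffB mcoeffX eqxx.
suff -> : (reduct (nm_row t) (nm_var t) 0 (nm_row t))@_(U_(nm_var t)) = 0.
  by rewrite subr0.
apply/eqP; rewrite mcoeff_eq0; apply/negP=> /(reductP t).1 [_].
by rewrite /plt tltxx.
Qed.

Lemma syzygies_lower t b m : m \in msupp (Syz t b) ->
  (m = U_(nm_var t)%MM /\ b = nm_row t) \/ plt m b U_(nm_var t)%MM (nm_row t).
Proof.
rewrite !mxE eqxx /= -[_ - _]/(_ + - _) => /msupp_addP[].
  case: eqP => [->|_]; last by rewrite mulr0 msupp0.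
  by rewrite mulr1 msuppX inE => /eqP->; left.
by rewrite (perm_mem (msuppN _)) => /(reductP t).1 [_]; right.
Qed.

(** The lead [X_j e_a] of a syzygy times a monomial in the variables from [j] on
    determines [a], and [j] as the least variable. *)
Lemma syzygies_free (z : 'rV[S]_#|nonmult B|) :
  terms (fun m t => vars_ge (nm_var t) m) z -> z *m Syz = 0 -> z = 0.
Proof.
apply: (free_of_leads hle syzygies_lead syzygies_lower) => t t' m m' hm hm' e ea.
apply: nm_inj => //; apply/val_inj; apply/eqP; rewrite eqn_leq; apply/andP; split.
  rewrite leqNgt; apply/negP=> lt.
  have /(congr1 (fun u : 'X_{1..n} => u (nm_var t'))) := e.
  rewrite !mnmDE !mnm1E eqxx (vars_geP _ _ hm) // -val_eqE /=.
  by rewrite (gtn_eqF lt) addn1.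
rewrite leqNgt; apply/negP=> lt.
have /(congr1 (fun u : 'X_{1..n} => u (nm_var t))) := e.
rewrite !mnmDE !mnm1E eqxx (vars_geP _ _ hm') // -val_eqE /=.
by rewrite (gtn_eqF lt) addn1.
Qed.

(** The order on relations between syzygies compares leading terms first. *)
Lemma syzygies_plt_of_plt m m' t t' :
  plt (m + U_(nm_var t))%MM (nm_row t) (m' + U_(nm_var t'))%MM (nm_row t') ->
  @plt (syzygies B) m t m' t'.
Proof.
have e k (c : 'I_r) u : (k + (pmon c + u) = k + u + pmon c)%MM.
  by rewrite addmA mnm_addAC.
rewrite /plt /tlt /= !e.
case/orP=> [->//|/andP[-> h]] /=; rewrite orbC.
suff -> : (pwt (nm_row t) * n + nm_var t < pwt (nm_row t') * n + nm_var t')%N by [].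
apply: leq_trans (leq_addr _ _); apply: leq_trans (leq_mul h (leqnn n)).
by rewrite mulSn addnC ltn_add2r.
Qed.

(** For [i < j], the combination [X_i s_j - X_j s_i] of the syzygies [s_j],
    [s_i] attached to a row [a] has no term [X_i X_j e_a], so all its terms are
    smaller and [syzygy_splits] rewrites it. The term [X_j s_i] has the same image
    as [X_i s_j]; it is smaller because the weight breaks ties by the variable. *)
Lemma syzygies_reduct t (i : 'I_n) : (i < nm_var t)%N ->
  exists p, @linear_reduct (syzygies B) t i p.
Proof.
set j := nm_var t; set a := nm_row t => ij.
have [t' [ta ti]] := nm_ex (ltn_trans ij (nm_varP t) : (i < pcls a)%N).
have [hj ej] := reductP t; have := reductP t'; rewrite ta ti => -[hi ei].
pose z := 'X_j *: reduct a i - 'X_i *: reduct a j.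
have zG : z *m G = 0.
  rewrite /z mulmxBl -!scalemxAl -ei -ej !scalerA.
  by rewrite mulrC subrr.
pose Q := fun m b => plt m b (U_(i) + U_(j))%MM a.
have Qz : terms Q z.
  have -> : z = 'X_j *: reduct a i + (-1)%:MP *: ('X_i *: reduct a j).
    by rewrite mpolyCN mpolyC1 scaleN1r.
  apply: termsD.
    apply: termsX; apply: termsW hi => m b [_ lt].
    exact: tlt_add.
  apply: termsC; apply: termsX; apply: termsW hj => m b [_ lt].
  by rewrite /Q (addmC U_(i)%MM U_(j)%MM); apply: tlt_add.
have [|w zE hw] := syzygy_splits _ Qz zG.
  by move=> m b m' b' q lt; apply: (tlt_trans hle) lt q.
exists ('X_j *: delta_mx 0 t' + w); split.
  apply: termsD.
    apply: terms_delta; split; first by rewrite /= ti; apply/vars_geU/ltnW.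
    rewrite /plt /tlt /= ta ti -/j -/a; apply/orP; right.
    rewrite ltn_add2l ij andbT; apply/eqP.
    by rewrite (addmC U_(j)%MM) mnm_addAC addmC.
  apply: termsW hw => m u [h1 h2]; split=> //.
  exact: syzygies_plt_of_plt.
rewrite mulmxDl -scalemxAl -rowE -zE !row_syzygies ta ti -/a -/j.
rewrite !scalerBr !scalerA /z addrA subrK [_ * _]mulrC.
by [].
Qed.

Lemma syzygies_pommaret : pommaret_basis (syzygies B).
Proof.
split; [|exact: syzygies_free|exact: syzygies_reduct].
by case: hB => -[D hD] _ _; exists D.+1 => t; rewrite mdegD hD mdeg1 addn1.
Qed.

End OneStep.

(** Iterating [syzygies] gives differentials with linear entries, so the basis
    elements in homological degree [i] can be placed in degree [i + d]. *)
Lemma pommaret_linear_resolution (M : S -> Prop) (d : int) r (G : 'cV[S]_r)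
    mon wt cls :
  pommaret_basis (@Pommaret r 1 G mon wt cls) ->
  (forall a, is_form d (G a 0)) ->
  (forall f, M f <-> exists v : 'rV_r, v *m G = f%:M) ->
  linear_resolution M d.
Proof.
set B0 := Pommaret _ _ _ _ => hB0 hG hM.
pose B i := iter i syzygies B0.
have hB i : pommaret_basis (B i).
  by elim: i => //= i; apply: syzygies_pommaret.
pose F := GComplex (grank := fun i => prows (B i))
  (fun i (_ : 'I_(prows (B i))) => i%:Z + d) (fun i => pgens (B i.+1)) G.
move=> i j ne; exists F.
  split=> //=.
  - move=> k a b; have -> : k.+1%:Z + d - (k%:Z + d) = 1.
      by rewrite opprD addrACA subrr addr0 -addn1 PoszD addrC addKr.
    exact: syzygies_linear.
  - by move=> a; rewrite add0r.
  - exact: (syzygies_exact (hB 0%N)).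
  - by move=> k; exact: (syzygies_exact (hB k.+1)).
rewrite /tor_dim.
have -> : deg_proj F i j = 0.
  apply/matrixP=> a b; rewrite !mxE /= eq_sym (negPf ne).
  by rewrite mul0rn.
by rewrite cap0mx mxrank0 sub0n.
Qed.

End Pommaret.

(** * Stable sets of monomials *)

Section StableMonomials.
Variable n : nat.
Implicit Types u m : 'X_{1..n}.

Definition maxvar u : nat := \max_(i < n | u i != 0%N) i.

Definition varsum u : nat := \sum_(i < n) i * u i.

Lemma le_maxvar u (i : 'I_n) : u i != 0%N -> (i <= maxvar u)%N.
Proof. by move=> ui; apply: (leq_bigmax_cond (F := fun i : 'I_n => val i)). Qed.

Lemma gt_maxvar u (i : 'I_n) : (maxvar u < i)%N -> u i = 0%N.
Proof. by move=> h; apply/eqP; apply: contraTT h => /le_maxvar; rewrite -leqNgt. Qed.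

Lemma maxvarP u : (0 < maxvar u)%N ->
  exists i : 'I_n, is_max_var u i /\ maxvar u = i.
Proof.
rewrite /maxvar => h.
have h0 : (0 < #|[pred i : 'I_n | u i != 0%N]|)%N.
  apply/card_gt0P; apply: NNPP => hno; move: h; rewrite big_pred0 // => i.
  by apply/negbTE/negP=> hi; apply: hno; exists i.
have [i ui e] := eq_bigmax_cond (fun i : 'I_n => val i) h0.
exists i; split; last exact: e.
by split=> // j uj; rewrite /= -e; apply: (leq_bigmax_cond (F := fun i : 'I_n => val i)).
Qed.

Lemma varsumD u m : varsum (u + m)%MM = (varsum u + varsum m)%N.
Proof.
by rewrite /varsum -big_split; apply: eq_bigr => i _; rewrite mnmDE mulnDr.
Qed.

Lemma varsumU (j : 'I_n) : varsum U_(j)%MM = j.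
Proof.
rewrite /varsum (bigD1 j) //= mnm1E eqxx muln1 big1 ?addn0 // => i ne.
by rewrite mnm1E eq_sym (negPf ne) muln0.
Qed.

(** Eliahou and Kervaire: in one degree, the products of a monomial by
    the variables from its last one on do not overlap: of two monomials with a
    common such product, one divides the other, and their degrees are equal. *)
Lemma stanley_inj u u' m m' :
  vars_ge (maxvar u) m -> vars_ge (maxvar u') m' -> mdeg u = mdeg u' ->
  (m + u = m' + u')%MM -> u = u'.
Proof.
wlog le_c : u u' m m' / (maxvar u <= maxvar u')%N.
  move=> h; have [/h //|/ltnW /h h'] := leqP (maxvar u) (maxvar u').
    by apply.
  by move=> h1 h2 h3 h4; apply/esym; apply: (h' m' m).
move=> /vars_geP hm /vars_geP hm' hd e.
have ei (i : 'I_n) : (m i + u i = m' i + u' i)%N by rewrite -!mnmDE e.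
have low (i : 'I_n) : (i < maxvar u)%N -> u i = u' i.
  by move=> ic; have := ei i; rewrite hm // hm' //; apply: leq_trans le_c.
have [/mnm_lepP h|] := boolP [forall i, u i <= u' i]%N.
  by apply: lem_mdeg_eq; rewrite ?hd //; apply/mnm_lepP.
case/forallPn=> i; rewrite -ltnNge => hi.
have ic : maxvar u = i.
  apply/eqP; rewrite eqn_leq; apply/andP; split.
    by rewrite leqNgt; apply/negP=> /low e1; rewrite e1 ltnn in hi.
  by apply: le_maxvar; rewrite -lt0n; apply: leq_ltn_trans hi.
have cc : maxvar u' = maxvar u.
  apply/eqP; rewrite eqn_leq le_c andbT leqNgt; apply/negP=> lt.
  have := ei i; rewrite hm' -?ic // add0n => e1.
  by move: hi; rewrite -e1 ltnNge leq_addl.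
apply/esym; apply: lem_mdeg_eq; last by rewrite hd.
apply/mnm_lepP=> k; case: (ltngtP k (maxvar u)) => [/low -> //|gt|ek].
  by rewrite gt_maxvar // cc.
by have -> : k = i; [apply/val_inj; rewrite /= ek|apply: ltnW].
Qed.

End StableMonomials.

(** Filtering by a mere proposition, such as membership in an ideal [I] given as
    a [Prop]-valued predicate. *)
Lemma seq_comprehension (T : eqType) (s : seq T) (P : T -> Prop) :
  exists s' : seq T, uniq s' /\ forall x, x \in s' <-> x \in s /\ P x.
Proof.
elim: s => [|x s [s' [us' hs']]]; first by exists [::]; split=> // x; split=> // -[].
case: (classic (P x)) => [Px|nPx]; last first.
  exists s'; split=> // y; rewrite hs' inE; split=> [[-> //]|[/predU1P[->|] //]].
  by split=> //; rewrite orbT.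
exists (undup (x :: s')); split=> [|y]; first exact: undup_uniq.
rewrite mem_undup !inE; split=> [/predU1P[->|/hs'[-> ?]]|[/predU1P[->|ys] Py]].
- by rewrite eqxx.
- by rewrite orbT.
- by rewrite eqxx.
- by apply/orP; right; apply/hs'.
Qed.

(** * Linear resolutions of the components *)

Section Main.
Local Open Scope ring_scope.
Variables (K : fieldType) (n : nat) (le : rel 'X_{1..n}).
Hypothesis hle : monomial_order le.
Local Notation S := {mpoly K[n]}.
Local Notation slt := (slt le).
Local Notation leads := (leads le).
Local Notation lead_form := (lead_form le).
Implicit Types (f g : S) (m u v : 'X_{1..n}).

Variable I : S -> Prop.
Hypothesis hI : graded_ideal I.
Hypothesis hst : stable_ideal (initial_ideal le I).

(** Stability, used to trade the variable [k] for the last variable of [u]; the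
    sum of the variable indices strictly drops when [k] is not already last, which
    breaks the tie between [X_k g_u] and [X_i g_u'], whose leads are equal. *)
Lemma stable_exchange u (k : 'I_n) : leads I u ->
  exists u' (i : 'I_n), [/\ leads I u', (u' + U_(i) = u + U_(k))%MM,
    (maxvar u' <= i)%N & (k < maxvar u)%N -> (varsum u' < varsum u)%N].
Proof.
move=> lu; have [hk|hk] := leqP (maxvar u) k; first by exists u, k.
have [i [hi ei]] := maxvarP (leq_ltn_trans (leq0n _) hk).
rewrite ei in hk; have ui : (U_(i) <= u)%MM.
  by apply/mnm_lepP=> j; rewrite mnm1E; case: eqP => // <-; rewrite lt0n; case: hi.
exists (U_(k) + (u - U_(i)))%MM, i.
have e : (U_(k) + (u - U_(i)) + U_(i) = u + U_(k))%MM.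
  by rewrite -addmA submK // addmC.
split=> //.
- case: hst => _ hs; have := hs u i k _ hi (ltnW hk).
  rewrite -mpolyXD => h; apply/(initial_idealX hle _ hI); apply: h.
  exact/(initial_idealX hle _ hI).
- apply/bigmax_leqP=> j; rewrite mnmDE mnm1E mnmBE.
  case: (k =P j) => [<- _|_]; first exact: ltnW.
  rewrite add0n => hj; case: hi => _; apply; apply: contraNneq hj => ->.
  by rewrite sub0n.
- move=> _; have := congr1 (@varsum n) e; rewrite !varsumD !varsumU => e1.
  by rewrite -(ltn_add2r i) e1 ltn_add2l.
Qed.

Hypothesis hb : exists b, total_betti I 0 b /\
  total_betti (initial_ideal le I) 0 b.

(** The elements with leads the degree [d] leads of [I] form a Pommaret basis. In
    degree [d.+1] every lead of the ideal that they generate is a variable times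
    one of these leads by [leads_of_linear_part], and [stable_exchange] makes the variable
    multiplicative, so division yields the linear reductions. *)
Lemma linear_resolution_ideal_part (d : nat) :
  linear_resolution (ideal_part I d) d.
Proof.
case: (hI) => idI _; have [_ _ IM] := idI.
have idpart : is_ideal (ideal_part I d) by apply: ideal_gen_ideal.
have [_ gD gM] := idpart.
pose all_d := [seq bmnm w | w <- enum {: 'X_{1..n < d.+1}}].
have [us [Uus hus]] := seq_comprehension all_d (fun u => leads I u /\ mdeg u = d).
pose r := size us; pose u (a : 'I_r) := tnth (in_tuple us) a.
have u_ex v : leads I v -> mdeg v = d -> exists a, u a = v.
  move=> lv dv; have : v \in us.
    apply/hus; split=> //; apply/mapP.
    have lt : (mdeg v < d.+1)%N by rewrite dv.
    by exists (BMultinom lt); rewrite ?mem_enum.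
  by case/(tnthP (in_tuple us))=> a ->; exists a.
have u_inj a b : u a = u b -> a = b.
  rewrite /u !(tnth_nth 0%MM) => /eqP; rewrite nth_uniq // => /eqP ?.
  exact: val_inj.
have hu a : leads I (u a) /\ mdeg (u a) = d.
  by have /hus[] := mem_tnth a (in_tuple us).
have exg a : exists g, I g /\ lead_form g (u a).
  by have [[g ? ?] _] := hu a; exists g.
have /fin_all_exists[g hg] := exg.
pose G : 'cV[S]_r := \col_a g a.
have rowG a : row a G = (g a)%:M by apply/rowP=> j; rewrite !mxE ord1.
have g_homog a : g a \is d.-homog.
  by have [_ h] := hg a; have := lead_form_homog h; rewrite (hu a).2.
have g_part a : ideal_part I d (g a).
  by apply: mem_ideal_gen; split; [case: (hg a)|exact: g_homog].
apply: (pommaret_linear_resolution hle (G := G) (mon := u)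
  (wt := fun a => varsum (u a)) (cls := fun a => maxvar (u a))).
- split=> /=.
  + by exists d => a; case: (hu a).
  + apply: (free_of_leads hle (mon := fun=> 0%MM) (wt := fun=> 0%N)
      (lm := u) (lc := fun=> 0)).
    * by move=> a; rewrite mxE; case: (hg a) => _ [].
    * move=> a b m; rewrite mxE => /(hg a).2.2 [->|h]; [left|right].
        by rewrite ord1.
      by rewrite /tlt !addm0 h.
    * move=> a b m m' hm hm' e _; apply: u_inj.
      by apply: stanley_inj hm hm' _ e; rewrite !(hu _).2.
  + move=> a j ja.
    have [u' [i [lu' e ci hw]]] := stable_exchange j (hu a).1.
    have du' : mdeg u' = d.
      have := congr1 (@mdeg n) e; rewrite !mdegD !mdeg1 (hu a).2; exact: addIn.
    have [b ub] := u_ex u' lu' du'; rewrite -ub in e ci hw.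
    pose th := (U_(j) + u a)%MM.
    pose Ared f := exists p : 'rV[S]_r, p *m G = f%:M /\
      terms (fun m c => vars_ge (maxvar (u c)) m /\ slt (m + u c)%MM th) p.
    (* Division in degree [d.+1], keeping all terms below [th]. *)
    have redP f : ideal_part I d f -> f \is d.+1.-homog ->
        (forall m, m \in msupp f -> slt m th) -> Ared f.
      apply: (lead_reduction hle idpart).
      * by exists 0; split; [rewrite mul0mx raddf0|exact: terms0].
      * move=> c f1 f2 [p1 [e1 t1]] [p2 [e2 t2]].
        exists (p1 + c%:MP *: p2); split.
          by rewrite mulmxDl e1 -scalemxAl e2 raddfD /= -mul_mpolyC scale_scalar_mx.
        by apply: termsD => //; apply: termsC.
      * by move=> m m' h h'; apply: (slt_trans hle) h' h.
      * move=> m [f1 If1 lf1] dm mth.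
        have [v [k [lv dv em]]] := leads_of_linear_part hle hI hb If1 lf1 dm.
        have [v' [i' [lv' e' ci' _]]] := stable_exchange k lv.
        have dv' : mdeg v' = d.
          have := congr1 (@mdeg n) e'; rewrite !mdegD !mdeg1 dv; exact: addIn.
        have [b' ub'] := u_ex v' lv' dv'; rewrite -ub' -em in e' ci'.
        exists (g b' * 'X_i'); split.
        -- by rewrite mulrC; apply: gM.
        -- exists ('X_i' *: delta_mx 0 b'); split.
             by rewrite -scalemxAl -rowE rowG scale_scalar_mx mulrC.
           by apply: terms_delta; rewrite addmC e'; split=> //; apply: vars_geU.
        -- by rewrite -e'; apply: lead_form_mulX; case: (hg b').
    (* Both products have lead [th], which cancels in the difference. *)
    have [|||p [pG tp]] := redP (g a * 'X_j - g b * 'X_i).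
    * rewrite -mulrN mulrC [_ * - _]mulrC; apply: gD; first exact: gM.
      exact: gM.
    * have h c (k : 'I_n) : g c * 'X_k \is d.+1.-homog.
        rewrite -addn1; apply: dhomogM => //.
        by apply/dhomogP=> m; rewrite msuppX inE => /eqP->; apply: mdeg1.
      by apply: rpredB; apply: h.
    * have [fa1 fa2] := lead_form_mulX hle U_(j)%MM (hg a).2.
      have [fb1 fb2] := lead_form_mulX hle U_(i)%MM (hg b).2.
      rewrite e in fb1 fb2; move=> m mf; rewrite /th addmC.
      have ne : m <> (u a + U_(j))%MM.
        move=> em; move: mf; rewrite em mcoeff_msupp mcoeffB fa1 fb1.
        by rewrite subrr eqxx.
      move: mf => /msupp_addP[/fa2[]//|].
      by rewrite (perm_mem (msuppN _)) => /fb2[].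
    exists ('X_i *: delta_mx 0 b + p); split.
      apply: termsD.
        apply: terms_delta; split=> /=; first exact: vars_geU.
        apply/orP; right; rewrite hw // andbT.
        by rewrite addmC e addmC.
      by apply: termsW tp => m c [h1 h2]; split=> //; apply/orP; left.
    rewrite mulmxDl -scalemxAl -rowE pG /= !rowG !scale_scalar_mx -raddfD /=.
    by rewrite addrC [_ * g a]mulrC [_ * g b]mulrC subrK.
- by move=> a; rewrite mxE; apply: g_homog.
- pose A f := exists v : 'rV_r, v *m G = f%:M.
  have idA : is_ideal A.
    split.
    + by exists 0; rewrite mul0mx raddf0.
    + by move=> f1 f2 [v1 h1] [v2 h2]; exists (v1 + v2); rewrite mulmxDl h1 h2 raddfD.
    + move=> f1 f2 [v2 h2]; exists (f1 *: v2).
      by rewrite -scalemxAl h2 scale_scalar_mx.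
  have Ag a : A (g a) by exists (delta_mx 0 a); rewrite -rowE rowG.
  move=> f; split.
    apply: (ideal_gen_min idA) => f1 [If1 /= df1].
    apply: (lead_reduction hle idI _ _ (P := fun=> True) _ _ If1 df1) => //.
    * by case: idA.
    * by move=> c f2 f3; apply: ideal_scaleD.
    * move=> m lm dm _; have [a ua] := u_ex m lm dm.
      by exists (g a); rewrite -ua; case: (hg a).
  case=> v /matrixP/(_ 0 0); rewrite !mxE mulr1n => <-.
  apply: ideal_sum => [|a _]; first exact: ideal_gen_ideal.
  by apply: gM; rewrite mxE.
Qed.

Lemma linear_resolution_negative (k : nat) :
  linear_resolution (ideal_part I (Negz k)) (Negz k).
Proof.
apply: (pommaret_linear_resolution hle (r := 0) (G := 0) (mon := fun=> 0%MM)
  (wt := fun=> 0%N) (cls := fun=> 0%N)).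
- split=> //=; first by exists 0%N; case.
  by move=> z _ _; apply: thinmx0.
- by case.
- move=> f; split.
    move=> hf; exists 0; rewrite mul0mx; suff -> : f = 0 by rewrite raddf0.
    apply: (ideal_gen_min (J := fun f => f = 0)) hf => [|g [_ /eqP]//].
    split=> // [f1 f2 -> ->|f1 f2 ->]; by rewrite ?addr0 ?mulr0.
  case=> v; rewrite mulmx0 => /matrixP/(_ 0 0); rewrite !mxE mulr1n => <-.
  by case: (ideal_gen_ideal (fun f => I f /\ is_form (Negz k) f)).
Qed.

End Main.

Theorem theorem2p3 (K : fieldType) (n : nat) (le : rel 'X_{1..n})
    (I : {mpoly K[n]} -> Prop)
    (hle : monomial_order le)
    (hI : graded_ideal I) (hI0 : nonzero_ideal I)
    (hst : stable_ideal (initial_ideal le I))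
    (hb : exists b : nat,
        total_betti I 0 b /\ total_betti (initial_ideal le I) 0 b) :
  componentwise_linear I.
Proof.
case=> d; first exact: linear_resolution_ideal_part hb d.
exact: (linear_resolution_negative hle).
Qed.
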